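(* Let $n\geq 3$, let $T\subseteq\Pi_n$ be a lower set such that $\{\pi\in\Pi_n : |\pi|=n-1\}\subseteq T$, and suppose that $|X_i|\geq 2$ for all $1\le i\le n$. Then there exists a probability measure $P\in\mathcal{M}(\mathbb{X}_n)$ such that $T[P]=0$ but $P\neq P_\pi$ for all $\pi\in\Pi_n\setminus\{\hat{\mathbf{1}}_n\}$.
   Context: $\Pi_n$ denotes the set of all partitions of $\{1,\dots,n\}$ into nonempty disjoint blocks, ordered by refinement: $\pi\le\sigma$ iff every block of $\pi$ is contained in a block of $\sigma$; $|\pi|$ is the number of blocks of $\pi$. $\hat{\mathbf{0}}_n$ is the partition into singletons and $\hat{\mathbf{1}}_n$ the one-block partition. A subset $T\subseteq\Pi_n$ is called a lower set if it contains $\hat{\mathbf 0}_n$ and $\hat{\mathbf 1}_n$ and, for every $w\in T\setminus\{\hat{\mathbf 1}_n\}$ and $z\in\Pi_n$ with $z\le w$, one has $z\in T$. Such $T$ carries the induced order, and $\mu$ denotes the M\''obius function of the poset $T$: $\mu(x,x)=1$, $\mu(x,y)=-\sum_{z\in T,\,x\le z<y}\mu(x,z)$ for $x<y$ in $T$, and $\mu(x,y)=0$ otherwise. $X_1,\dots,X_n$ are sets, $\mathbb{X}_n=X_1\times\cdots\times X_n$, and $\mathcal{M}(\mathbb{X}_n)$ is the vector space of discrete signed measures on $\mathbb{X}_n$ (finite real linear combinations of Dirac measures). For a probability measure $P\in\mathcal{M}(\mathbb{X}_n)$ and nonempty $F\subseteq\{1,\dots,n\}$, $P_F$ is the marginal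 of $P$ on $\prod_{i\in F}X_i$; for $\pi=(F_1,\dots,F_\ell)\in\Pi_n$, $P_\pi:=P_{F_1}\times\cdots\times P_{F_\ell}$, viewed as a measure on $\mathbb{X}_n$. The interaction is the signed measure $T[P]:=\sum_{\pi\in T}\mu(\pi,\hat{\mathbf{1}}_n)P_\pi$. *)

(* Defs.v *)
From mathcomp Require Import all_boot all_order all_algebra.

Set Implicit Arguments.
Unset Strict Implicit.
Unset Printing Implicit Defensive.

Import Order.TTheory GRing.Theory Num.Theory.
Local Open Scope ring_scope.

Section Mobius.
Context (I : finType) (le : rel I) (S : {set I}).

(* The recursion is on [k], an upper bound for the length of the chains of [S]
   below [y]; [#|S|] always suffices, see [mobius_lt]. *)
Fixpoint mobius_rec (k : nat) (x y : I) : int :=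
  if x == y then 1
  else if k is k'.+1 then
    if le x y
    then - \sum_(z in S | le x z && (le z y && (z != y))) mobius_rec k' x z
    else 0
  else 0.

Definition mobius (x y : I) : int := mobius_rec #|S| x y.

Lemma mobius_refl x : mobius x x = 1.
Proof. by rewrite /mobius; case: #|S| => [|k] /=; rewrite eqxx. Qed.

Lemma mobius_nle x y : x != y -> ~~ le x y -> mobius x y = 0.
Proof.
move=> /negPf xy /negPf lexy; rewrite /mobius.
by case: #|S| => [|k] /=; rewrite xy ?lexy.
Qed.

Hypothesis le_trans : {in S & &, transitive le}.
Hypothesis le_anti : {in S &, antisymmetric le}.

Let below y := #|[set z in S | le z y && (z != y)]|.

Let below_lt y z : y \in S -> z \in S -> le z y -> z != y ->
  (below z < below y)%N.
Proof.
move=> yS zS zy nzy; apply/proper_card/properP; split.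
  apply/subsetP => w; rewrite !inE => /and3P[wS wz nwz].
  rewrite wS (le_trans zS wS yS wz zy) /=.
  apply: contraNneq nwz => wy; subst w.
  by rewrite (le_anti yS zS) // wz zy.
by exists z; rewrite !inE ?zS ?zy ?nzy // eqxx !andbF.
Qed.

Let mobius_rec_fuel x k k' y : x \in S -> y \in S ->
  (below y <= k)%N -> (below y <= k')%N -> mobius_rec k x y = mobius_rec k' x y.
Proof.
move=> xS; elim: k k' y => [|k IHk] [|k'] y yS hk hk' //=;
  case: (eqVneq x y) => // nxy; case: ifPn => // lexy.
- by have := leq_trans (below_lt yS xS lexy nxy) hk.
- by have := leq_trans (below_lt yS xS lexy nxy) hk'.
congr (- _); apply: eq_bigr => z /and4P[zS _ zy nzy].
by apply: IHk => //; rewrite -ltnS; apply: leq_trans (below_lt yS zS zy nzy) _.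
Qed.

Lemma mobius_lt x y : x \in S -> y \in S -> le x y -> x != y ->
  mobius x y = - \sum_(z in S | le x z && (le z y && (z != y))) mobius x z.
Proof.
move=> xS yS lexy nxy.
have belowS w : (below w <= #|S|)%N.
  by apply/subset_leq_card/subsetP => z; rewrite inE => /andP[].
rewrite {1}/mobius (@mobius_rec_fuel x _ #|S|.+1) ?leqW //=.
by rewrite (negPf nxy) lexy.
Qed.

End Mobius.

Section Partitions.
Context (n : nat).

Definition Pi : {set {set {set 'I_n}}} := [set pi | partition pi [set: 'I_n]].

Definition refines : rel {set {set 'I_n}} :=
  fun pi sigma => [forall F in pi, exists G in sigma, F \subset G].

Definition zero_hat : {set {set 'I_n}} := [set [set i] | i : 'I_n].

(* This is a partition only for [0 < n]. *)
Definition one_hat : {set {set 'I_n}} := [set [set: 'I_n]].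

Definition lower_set (T : {set {set {set 'I_n}}}) : Prop :=
  [/\ T \subset Pi, zero_hat \in T, one_hat \in T &
      forall w z, w \in T -> w != one_hat -> z \in Pi -> refines z w -> z \in T].

Lemma refines_trans : transitive refines.
Proof.
move=> s p t /forall_inP ps /forall_inP st; apply/forall_inP => F /ps.
move=> /exists_inP[G /st /exists_inP[H Ht GH] FG].
by apply/exists_inP; exists H => //; apply: subset_trans GH.
Qed.

Lemma refines_anti : {in Pi &, antisymmetric refines}.
Proof.
suff sub p s : p \in Pi -> refines p s -> refines s p -> p \subset s.
  by move=> p s pP sP /andP[ps sp]; apply/eqP; rewrite eqEsubset !sub.
rewrite inE => /and3P[_ /trivIsetP tp p0] /forall_inP ps /forall_inP sp.
apply/subsetP => F Fp; have /exists_inP[G Gs FG] := ps _ Fp.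
have /exists_inP[H Hp GH] := sp _ Gs.
have [FH|/(tp _ _ Fp Hp)] := eqVneq F H.
  by have -> : F = G by apply/eqP; rewrite eqEsubset FG FH.
rewrite disjoints_subset => dFH; case/negP: p0.
suff <- : F = set0 by [].
apply/eqP; rewrite -subset0; apply/subsetP => i iF.
by have := subsetP dFH _ iF; rewrite inE (subsetP GH) // (subsetP FG).
Qed.

End Partitions.

Arguments zero_hat n : clear implicits.
Arguments one_hat n : clear implicits.

From mathcomp Require Import all_classical all_reals.
From mathcomp Require Import numfun.

Section Measures.
Local Open Scope classical_set_scope.
Context (R : realType).

(* A discrete signed measure on [T] is defined on all subsets of [T]. *)
Definition discrete_measure (T : Type) (m : set T -> R) : Prop :=
  exists s : seq (R * T),
    forall A : set T, m A = \sum_(p <- s) p.1 * \1_A p.2.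

Definition discrete_probability (T : Type) (m : set T -> R) : Prop :=
  [/\ discrete_measure m, forall A, 0 <= m A & m setT = 1].

Context (n : nat) (X : 'I_n -> choiceType).

Definition restr (F : {set 'I_n}) (x : forall i, X i) :
    forall i : {i : 'I_n | i \in F}, X (val i) :=
  fun i => x (val i).

Definition marginal (P : set (forall i, X i) -> R) (F : {set 'I_n}) :
    set (forall i : {i : 'I_n | i \in F}, X (val i)) -> R :=
  fun B => P (@restr F @^-1` B).

(* The product of discrete measures [m F], for [F] ranging over the blocks of
   the partition [pi], is given by its masses at points; the sum over [A] is
   that of [fsbigop], over the finitely many points of nonzero mass. *)
Definition block_product (pi : {set {set 'I_n}})
    (m : forall F : {set 'I_n},
           set (forall i : {i : 'I_n | i \in F}, X (val i)) -> R) :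
    set (forall i, X i) -> R :=
  fun A => \sum_(x \in A) \prod_(F in pi) m F [set restr x].

Definition product_marginals (P : set (forall i, X i) -> R)
    (pi : {set {set 'I_n}}) : set (forall i, X i) -> R :=
  block_product pi (marginal P).

Lemma discrete_product_marginals (P : set (forall i, X i) -> R)
    (pi : {set {set 'I_n}}) :
  pi \in Pi n -> discrete_measure P ->
  discrete_measure (product_marginals P pi).
Proof.
rewrite inE => /and3P[/eqP cov _ _] [s Ps].
pose mass (x : forall i, X i) := \prod_(F in pi) marginal P [set restr (F := F) x].
have fin : finite_set (mass @^-1` [set~ 0]).
  pose g (j : {ffun 'I_n -> 'I_(size s)}) (i : 'I_n) : X i :=
    (tnth (in_tuple s) (j i)).2 i.
  apply: (@sub_finite_set _ _ (range g)); last exact/finite_image/finite_finset.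
  move=> x /= /eqP; rewrite prodf_seq_neq0 => /allP mass0.
  have ex i : exists k : 'I_(size s), (tnth (in_tuple s) k).2 i = x i.
    have : i \in finset.cover pi by rewrite cov finset.inE.
    case/finset.bigcupP => F Fpi iF.
    have := mass0 F (mem_index_enum _); rewrite Fpi /= /marginal Ps.
    apply: contra_neqP => /forallNP nk; rewrite big_tnth big1 // => k _.
    rewrite indicE memNset ?mulr0 //= => /(congr1 (fun h => h (exist _ i iF))).
    exact: nk.
  have [j jE] := choice ex.
  exists [ffun i => j i] => //; apply: functional_extensionality_dep => i.
  by rewrite /g ffunE.
exists [seq (mass x, x) | x <- finite_support 0 setT mass] => A.
rewrite big_map /= /product_marginals /block_product.
rewrite -[LHS]/(\sum_(x \in A) mass x) fsbig_mkcond.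
have memS x : mass x != 0 -> x \in finite_support 0 setT mass.
  move=> mx; rewrite in_finite_support ?setTI // inE /=.
  exact/eqP.
rewrite (fsbigE _ _ (finite_support_uniq 0 setT mass)) //=.
- apply: eq_big => [x|x _]; first by rewrite in_setT.
  by rewrite /patch indicE; case: (x \in A); rewrite ?mulr1 ?mulr0.
- move=> x _; apply: contraNeq => mx; apply: memS.
  by apply: contra_neq mx; rewrite /patch; case: ifP => // _ ->.
Qed.

Definition interaction (T : {set {set {set 'I_n}}})
    (P : set (forall i, X i) -> R) : set (forall i, X i) -> R :=
  fun A => \sum_(pi in T)
    (mobius (@refines n) T pi (one_hat n))%:~R * product_marginals P pi A.

End Measures.

(* Main.v *)
Require Import Defs.
From mathcomp Require Import all_boot all_order all_algebra.
From mathcomp Require Import all_classical all_reals.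
From mathcomp Require Import numfun.
Set Implicit Arguments.
Unset Strict Implicit.
Unset Printing Implicit Defensive.
Import Order.TTheory GRing.Theory Num.Theory.
Local Open Scope ring_scope.

(** The idea is to perturb the uniform measure on a cube by pairwise
    correlations that all share one coordinate [o], so that every [P_pi] depends
    linearly on the perturbation.

    Choose two points in each [X i], so that the sign vectors [w] of length [n]
    embed in the product, and let [chi_j w] be the sign of coordinate [j].
    Relative to the uniform measure on the embedded cube, [P] has the density
    [1 + n^-1 * \sum_(j != o) chi_o * chi_j], which is nonnegative as the sum has
    [n - 1] terms.  By orthogonality of the characters, a marginal of [P] on [F]
    is uniform when [o] is not in [F], and otherwise keeps exactly the terms
    with [j] in [F].  As only one block of [pi] contains [o], there are no
    cross terms: [P_pi] has the density
    [1 + n^-1 * \sum_(j != o, j in the block of o) chi_o * chi_j]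
    ([product_star_measure]).

    The coefficients of [T[P]] are therefore the sums of [mu(pi, 1)] over the
    [pi] in [T] above [s], where [s] is the partition into singletons for the
    constant term, and the partition merging just [o] and [j] for the term
    [chi_o * chi_j].  These [s] lie in [T], by hypothesis for the second kind,
    and they are not the top since [n >= 3], so the sums vanish
    ([mobius_sum_above]).  Finally, if [pi] is not the top, some [j] is not in
    the block of [o]; [P_pi] then lacks the term [chi_o * chi_j] and gives less
    mass than [P] to the point where all the signs are [1]. *)

(** * The dual recursion for the Moebius function *)

Section MobiusDual.
Context (I : finType) (le : rel I) (S : {set I}).
Hypotheses (le_refl : {in S, reflexive le}) (le_trans : {in S & &, transitive le})
  (le_anti : {in S &, antisymmetric le}).

(** The defining recursion in the form of an identity of matrices, the matrix
    of [mobius] times the zeta matrix being [1], so that it can be transposed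
    to the other argument. *)
Lemma mobius_sum_lower x y : x \in S -> y \in S ->
  \sum_(z in S | le z y) mobius le S x z = (x == y)%:R.
Proof.
move=> xS yS; have [<-{y yS}|nxy] := eqVneq x y.
  rewrite (bigD1 x) ?xS ?le_refl //= mobius_refl big1 ?addr0 // => z.
  case/andP=> /andP[zS lezx] nzx; apply: mobius_nle; first by rewrite eq_sym.
  by apply: contra nzx => lexz; apply/eqP/le_anti; rewrite // lezx lexz.
have [lexy|nlexy] := boolP (le x y); last first.
  rewrite big1 // => z /andP[zS lezy]; apply: mobius_nle.
    by apply: contraNneq nlexy => ->.
  by apply: contra nlexy => lexz; apply: (le_trans zS xS yS).
rewrite (bigD1 y) ?yS ?le_refl //= mobius_lt // addrC; apply/eqP.
rewrite subr_eq0; apply/eqP; rewrite (bigID (le x)) /= [X in _ + X]big1 ?addr0.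
  by apply: eq_bigl => z; case: (z \in S); case: (le x z); rewrite ?andbT ?andbF.
move=> z /andP[_ nlexz]; apply: mobius_nle => //.
by apply: contraNneq nlexz => <-; apply: le_refl.
Qed.

(** A left inverse of a square matrix over a commutative ring is also a right
    inverse, so the recursion holds in the other argument as well. *)
Lemma mobius_sum_upper x y : x \in S -> y \in S ->
  \sum_(z in S | le x z) mobius le S z y = (x == y)%:R.
Proof.
move=> xS yS.
pose M := \matrix_(i < #|S|, j < #|S|) mobius le S (enum_val i) (enum_val j).
pose Z : 'M[int]_#|S| := \matrix_(i, j) (le (enum_val i) (enum_val j))%:R.
have MZ : M *m Z = 1%:M.
  apply/matrixP => i j; rewrite !mxE.
  rewrite -(inj_eq enum_val_inj) -mobius_sum_lower ?enum_valP //.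
  rewrite [RHS]big_mkcondr [RHS]big_enum_val /=; apply: eq_bigr => k _.
  by rewrite !mxE; case: ifP; rewrite ?mulr1 ?mulr0.
have /matrixP/(_ (enum_rank_in xS x) (enum_rank_in xS y)) := mulmx1C MZ.
rewrite !mxE -(inj_eq enum_val_inj) !enum_rankK_in // => <-.
rewrite big_mkcondr big_enum_val /=; apply: eq_bigr => k _.
by rewrite !mxE !enum_rankK_in //; case: ifP; rewrite ?mul1r ?mul0r.
Qed.

End MobiusDual.

(** * Partitions merging two points *)

Section Partitions.
Context (n : nat).
Implicit Types (i j o : 'I_n) (pi : {set {set 'I_n}}).

Definition merge i j : {set {set 'I_n}} :=
  [set i; j] |: [set [set k] | k in ~: [set i; j]].

Lemma merge_blocks i j :
  finset.partition (merge i j) [set: 'I_n] /\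
    [set i; j] \notin [set [set k] | k in ~: [set i; j]].
Proof.
set A := [set i; j].
have dA : {in [set [set k] | k in ~: A], forall B : {set 'I_n}, [disjoint A & B]}.
  move=> _ /imsetP[k + ->]; rewrite inE => kA.
  by rewrite disjoint_sym disjoints1.
have t1 : finset.trivIset [set [set k] | k in ~: A].
  apply/finset.trivIsetP => _ _ /imsetP[k _ ->] /imsetP[l _ ->] nkl.
  by rewrite disjoints1 inE; apply: contraNneq nkl => ->.
have n0 : finset.set0 \notin [set [set k] | k in ~: A].
  by apply/imsetP => -[k _ /setP/(_ k)]; rewrite !inE eqxx.
have [tA nA] := finset.trivIsetU1 dA t1 n0; split=> //.
apply/and3P; split => //.
  apply/eqP/setP => k; rewrite finset.inE; apply/finset.bigcupP.
  have [kA|kA] := boolP (k \in A); first by exists A; rewrite // finset.inE finset.set11.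
  exists [set k]; rewrite ?finset.set11 //; apply/finset.setU1P; right.
  by apply: imset_f; rewrite finset.inE.
rewrite finset.in_setU1 negb_or n0 andbT.
by apply/eqP => /setP/(_ i); rewrite !inE eqxx.
Qed.

Lemma merge_Pi i j : merge i j \in Pi n.
Proof. by rewrite inE; case: (merge_blocks i j). Qed.

Lemma card_merge i j : i != j -> #|merge i j| = n.-1.
Proof.
move=> nij; rewrite cardsU1 (merge_blocks i j).2 card_imset; last exact: finset.set1_inj.
rewrite finset.cardsCs finset.setCK card_ord cards2 nij /=.
have : (#|[set i; j]| <= n)%N by rewrite -[n in leqRHS]card_ord max_card.
by rewrite cards2 nij /=; case: (n) => [|[|m]] // _; rewrite add1n !subSS subn0.
Qed.

Lemma mem_pblock_Pi pi i : pi \in Pi n -> i \in finset.pblock pi i.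
Proof. by rewrite inE => /and3P[/eqP cov _ _]; rewrite finset.mem_pblock cov inE. Qed.

Lemma pblock_Pi pi i : pi \in Pi n -> finset.pblock pi i \in pi.
Proof. by rewrite inE => /and3P[/eqP cov _ _]; rewrite finset.pblock_mem ?cov ?inE. Qed.

Lemma refines_merge i j pi : pi \in Pi n ->
  refines (merge i j) pi = (j \in finset.pblock pi i).
Proof.
move=> piP; have /and3P[_ tri _] : finset.partition pi [set: 'I_n] by rewrite inE in piP.
apply/forall_inP/idP => [/(_ [set i; j])|jB F].
  rewrite finset.setU11 => /(_ isT)/exists_inP[G Gpi /fintype.subsetP sG].
  by rewrite (@finset.def_pblock _ _ G) ?sG ?inE ?eqxx ?orbT.
case/finset.setU1P => [->|/imsetP[k _ ->]]; apply/exists_inP.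
  exists (finset.pblock pi i); first exact: pblock_Pi.
  by apply/fintype.subsetP => k; rewrite !inE => /orP[]/eqP-> //; apply: mem_pblock_Pi.
by exists (finset.pblock pi k); rewrite ?finset.sub1set ?mem_pblock_Pi ?pblock_Pi.
Qed.

Lemma refines_zero_hat pi : pi \in Pi n -> refines (zero_hat n) pi.
Proof.
move=> piP; apply/forall_inP => _ /imsetP[k _ ->]; apply/exists_inP.
by exists (finset.pblock pi k); rewrite ?finset.sub1set ?mem_pblock_Pi ?pblock_Pi.
Qed.

Lemma refines_refl pi : refines pi pi.
Proof. by apply/forall_inP => F Fpi; apply/exists_inP; exists F. Qed.

Lemma pblock_one_hat pi i : pi \in Pi n -> finset.pblock pi i = [set: 'I_n] ->
  pi = one_hat n.
Proof.
rewrite inE => /and3P[/eqP cov tri n0] Bi.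
have Tpi : [set: 'I_n] \in pi by rewrite -Bi finset.pblock_mem ?cov ?inE.
apply/setP => F; rewrite finset.in_set1; apply/idP/eqP => [Fpi|->//].
have [k kF] : exists k, k \in F.
  by apply/finset.set0Pn; apply: contraNneq n0 => <-.
by rewrite -(finset.def_pblock tri Fpi kF) (finset.def_pblock tri Tpi) ?inE.
Qed.

(** What makes the coefficients of the interaction vanish. *)
Lemma mobius_sum_above (T : {set {set {set 'I_n}}}) s :
  T \subset Pi n -> s \in T -> one_hat n \in T -> s != one_hat n ->
  \sum_(pi in T | refines s pi) mobius (@refines n) T pi (one_hat n) = 0.
Proof.
move=> /fintype.subsetP TPi sT oT /negPf ns1; rewrite mobius_sum_upper ?ns1 //.
- by move=> pi _; apply: refines_refl.
- by move=> x y z _ _ _; apply: refines_trans.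
- by move=> x y /TPi xP /TPi yP; apply: refines_anti.
Qed.

End Partitions.

(** * Characters of the cube *)

Section Fourier.
Context (R : realFieldType) (n : nat).
Implicit Types (F D : {set 'I_n}) (v w : {ffun 'I_n -> bool}).

Definition chi D w : R := \prod_(i in D) (-1) ^+ w i.

Definition agree F w v := [forall i in F, w i == v i].

(** Integrating a character of the cube over the coordinates outside [F]: the
    integrand is a product over the coordinates, and a coordinate of [D] outside
    [F] contributes the mean of a sign, which is [0]. *)
Lemma sum_chi_agree F D v :
  \sum_(w | agree F w v) 2^-1 ^+ n * chi D w =
  2^-1 ^+ #|F| * (if D \subset F then chi D v else 0).
Proof.
(* The summand extended by zero, as a product over the coordinates. *)
pose g i (b : bool) : R :=
  2^-1 * ((i \in F) ==> (b == v i))%:R * (if i \in D then (-1) ^+ b else 1).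
have gE w : (if agree F w v then 2^-1 ^+ n * chi D w else 0) = \prod_i g i (w i).
  rewrite !big_split /= prodr_const card_ord -big_mkcond /=.
  have [/forall_inP ag|] := boolP (agree F w v).
    rewrite [X in _ * X * _]big1 ?mulr1 // => i _.
    by case: (boolP (i \in F)) => // iF; rewrite (ag i iF).
  rewrite negb_forall_in => /exists_inP[i iF nwv].
  by rewrite (bigD1 i) //= iF (negPf nwv) !(mul0r, mulr0).
rewrite big_mkcond (eq_bigr _ (fun w _ => gE w)) -bigA_distr_bigA /=.
have sg i : \sum_b g i b = (if i \in F then 2^-1 else 1) *
    (if i \in D then if i \in F then (-1) ^+ v i else 0 else 1).
  rewrite big_bool /g; case: (i \in F) => /=.
    by case: (v i); case: (i \in D); rewrite /= !(mulr1, mulr0, mul0r, addr0, add0r).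
  rewrite !mulr1 mul1r; case: (i \in D); rewrite -mulrDr /= ?expr0.
    by rewrite expr1 addNr mulr0.
  by rewrite mulVf // pnatr_eq0.
rewrite (eq_bigr _ (fun i _ => sg i)) big_split /= -big_mkcond prodr_const.
congr (_ * _); rewrite -big_mkcond /=; case: ifPn => [/fintype.subsetP DF|].
  by apply: eq_bigr => i /DF ->.
by case/fintype.subsetPn => i iD niF; rewrite (bigD1 i) //= (negPf niF) mul0r.
Qed.

Lemma normr_chi D w : `|chi D w| = 1.
Proof. by rewrite normr_prod big1 // => i _; rewrite normrX normrN1 expr1n. Qed.

(** The correlations form a star graph centred at [o] with leaves [J].  For
    [j = o] the set [[set o; j]] is a singleton, so [J] is meant to avoid [o]. *)
Definition star o (J : {set 'I_n}) w : R := 1 + n%:R^-1 * \sum_(j in J) chi [set o; j] w.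

Lemma star_ge0 o w : 0 <= star o (~: [set o]) w.
Proof.
have n_gt0 : (0 < n)%N by apply: leq_ltn_trans (ltn_ord o).
rewrite /star -[X in 1 + X]opprK subr_ge0; apply: le_trans (ler_norm _) _.
rewrite normrN normrM normfV normr_nat mulrC ler_pdivrMr ?ltr0n // mul1r.
apply: le_trans (ler_norm_sum _ _ _) _.
rewrite (eq_bigr _ (fun j _ => normr_chi [set o; j] w)) sumr_const ler_nat.
by rewrite -[n in leqRHS]card_ord max_card.
Qed.

End Fourier.

(** * Measures with a star of correlations *)

Section StarMeasure.
Context (R : realType) (n : nat) (X : 'I_n -> choiceType) (a b : forall i, X i).
Hypothesis ab : forall i, a i <> b i.
Implicit Types (F J : {set 'I_n}) (v w : {ffun 'I_n -> bool}) (o : 'I_n).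

Definition embed w (i : 'I_n) : X i := if w i then a i else b i.

Lemma embed_eq v w i : embed w i = embed v i <-> w i = v i.
Proof.
rewrite /embed; split => [|->//].
by case: (w i); case: (v i) => //; [move/ab | move/esym/ab].
Qed.

Lemma embed_inj : injective embed.
Proof.
by move=> v w vw; apply/ffunP => i; apply/embed_eq; rewrite vw.
Qed.

Definition star_measure o J (A : set (forall i, X i)) : R :=
  \sum_w 2^-1 ^+ n * star R o J w * \1_A (embed w).

(** The character of [{o, j}] survives on [F] only if [F] contains both [o]
    and [j]. *)
Lemma marginal_star_measure o J F v :
  marginal (star_measure o J) [set restr (F := F) (embed v)]%classic =
  2^-1 ^+ #|F| * star R o (if o \in F then J :&: F else finset.set0) v.
Proof.
rewrite /marginal /star_measure.
have -> : \sum_w 2^-1 ^+ n * star R o J w *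
      \1_(@restr n X F @^-1` [set restr (embed v)])%classic (embed w) =
    \sum_(w | agree F w v) 2^-1 ^+ n * star R o J w.
  rewrite [RHS]big_mkcond; apply: eq_bigr => w _; rewrite indicE.
  suff -> : (embed w \in (@restr n X F @^-1` [set restr (embed v)])%classic) = agree F w v.
    by case: ifP; rewrite ?mulr1 ?mulr0.
  apply/idP/forall_inP => [|ag].
    rewrite inE /= => wv i iF; apply/eqP/embed_eq.
    exact: (congr1 (fun h => h (exist _ i iF)) wv).
  rewrite inE /=; apply: functional_extensionality_dep => -[i iF].
  by apply/embed_eq/eqP/ag.
have chi0 w : chi R finset.set0 w = 1 by rewrite /chi big_set0.
rewrite (eq_bigr (fun w => 2^-1 ^+ n * chi R finset.set0 w +
   n%:R^-1 * \sum_(j in J) 2^-1 ^+ n * chi R [set o; j] w)); last first.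
  by move=> w _; rewrite chi0 -mulr_sumr mulrCA -mulrDr.
rewrite big_split /= sum_chi_agree finset.sub0set chi0 -mulr_sumr exchange_big /=.
rewrite (eq_bigr _ (fun j _ => sum_chi_agree R F [set o; j] v)) -mulr_sumr mulrCA -mulrDr.
congr (_ * (1 + _ * _)); rewrite -big_mkcondr; apply: eq_bigl => j.
by rewrite finset.subUset !finset.sub1set; case: (o \in F); rewrite !inE // andbF.
Qed.

(** The block of [o] is the only one whose marginal is not uniform, so the
    product of the marginals is again the measure of a star. *)
Lemma product_star_measure o J pi : pi \in Pi n ->
  product_marginals (star_measure o J) pi =
  star_measure o (J :&: finset.pblock pi o).
Proof.
move=> piP; have partP : finset.partition pi [set: 'I_n] by rewrite inE in piP.
have /and3P[_ tri _] := partP.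
apply/funext => A; rewrite /product_marginals /block_product.
pose mass (x : forall i, X i) :=
  \prod_(F in pi) marginal (star_measure o J) [set restr (F := F) x]%classic.
have massE v : mass (embed v) = 2^-1 ^+ n * star R o (J :&: finset.pblock pi o) v.
  rewrite /mass (eq_bigr _ (fun F _ => marginal_star_measure o J F v)) big_split /=.
  congr (_ * _).
    by rewrite prodrXr -(finset.card_partition partP) finset.cardsT card_ord.
  rewrite (bigD1 _ (pblock_Pi o piP)) /= mem_pblock_Pi // big1 ?mulr1 // => F /andP[Fpi nF].
  rewrite ifN /star ?big_set0 ?mulr0 ?addr0 //.
  by apply: contra nF => oF; rewrite (finset.def_pblock tri Fpi oF).
(* Outside the cube some coordinate of [x] is not charged by the marginals. *)
have mass0 x : ~ range embed x -> mass x = 0.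
  move=> nx; have [i [nai nbi]] : exists i, x i <> a i /\ x i <> b i.
    apply: contrapT => /forallNP h; apply: nx.
    exists [ffun i => `[< x i = a i >]] => //; apply: functional_extensionality_dep => i.
    rewrite /embed ffunE; case: asboolP => // nxa.
    by apply: contrapT => nxb; apply: (h i); split => // /esym.
  rewrite /mass (bigD1 _ (pblock_Pi i piP)) /= [X in X * _](_ : _ = 0) ?mul0r //.
  rewrite /marginal /star_measure big1 // => w _.
  rewrite indicE memNset ?mulr0 //= => /(congr1 (fun h => h (exist _ i (mem_pblock_Pi i piP)))).
  by rewrite /restr /= /embed; case: (w i) => /esym.
rewrite -[LHS]/(\sum_(x \in A) mass x) fsbig_mkcond.
rewrite (fsbigE [seq embed w | w <- enum {ffun 'I_n -> bool}]) //=.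
- rewrite big_map big_enum_cond /=; apply: eq_big => [w|w _]; first by rewrite in_setT.
  by rewrite /patch indicE massE; case: (_ \in A); rewrite ?mulr1 ?mulr0.
- by rewrite map_inj_uniq ?enum_uniq //; apply: embed_inj.
- move=> x _ nx; rewrite /patch; case: ifP => // _; apply: mass0 => -[w _ wx].
  by case/negP: nx; apply/mapP; exists w; rewrite ?mem_enum.
Qed.

Lemma discrete_probability_star_measure o :
  discrete_probability (star_measure o (~: [set o])).
Proof.
split.
- exists [seq (2^-1 ^+ n * star R o (~: [set o]) w, embed w) |
    w <- enum {ffun 'I_n -> bool}] => A.
  by rewrite big_map big_enum.
- move=> A; apply: sumr_ge0 => w _; rewrite indicE.
  by rewrite !mulr_ge0 ?star_ge0 ?exprn_ge0 ?invr_ge0 ?ler0n.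
(* A marginal on no coordinates lives on a one-point space. *)
- have <- : marginal (star_measure o (~: [set o]))
      [set restr (F := finset.set0) (embed [ffun=> true])]%classic =
      star_measure o (~: [set o]) setT.
    congr star_measure; apply/seteqP; split=> // x _.
    by apply: functional_extensionality_dep => -[i i0]; exfalso; rewrite finset.in_set0 in i0.
  rewrite marginal_star_measure finset.in_set0 finset.cards0 expr0 mul1r.
  by rewrite /star big_set0 mulr0 addr0.
Qed.

(** All characters are [1] at this point, so its mass counts the leaves. *)
Lemma star_measure_point o J :
  star_measure o J [set embed [ffun=> false]]%classic =
  2^-1 ^+ n * (1 + n%:R^-1 * #|J|%:R).
Proof.
rewrite /star_measure (bigD1 [ffun=> false]) //= big1 => [|w nw].
  rewrite indicE mem_set // mulr1 addr0 /star; congr (_ * (1 + _ * _)).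
  rewrite -sumr_const; apply: eq_bigr => j _.
  by rewrite /chi big1 // => i _; rewrite ffunE expr0.
by rewrite indicE memNset ?mulr0 //= => /embed_inj; apply/eqP.
Qed.

Lemma star_measure_neq_product o pi : pi \in Pi n -> pi != one_hat n ->
  star_measure o (~: [set o]) <> product_marginals (star_measure o (~: [set o])) pi.
Proof.
move=> piP npi1; rewrite product_star_measure //.
move/(congr1 (fun m => m [set embed [ffun=> false]]%classic)).
have n_gt0 : (0 < n)%N by apply: leq_ltn_trans (ltn_ord o).
(* Equal masses force the block of [o] to contain all the leaves. *)
rewrite !star_measure_point => /mulfI => /(_ (expf_neq0 _ _)).
rewrite invr_neq0 ?pnatr_eq0 // => /(_ isT)/addrI/mulfI.
rewrite invr_neq0 ?pnatr_eq0 -?lt0n // => /(_ isT)/eqP; rewrite eqr_nat => /eqP cE.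
case/eqP: npi1; apply: (pblock_one_hat piP (i := o)); apply/eqP.
rewrite -finset.subTset; apply/fintype.subsetP => j _.
have [->|njo] := eqVneq j o.
  exact: mem_pblock_Pi.
have /eqP/setP/(_ j) : ~: [set o] :&: finset.pblock pi o == ~: [set o].
  by rewrite eqEcard finset.subsetIl cE /=.
by rewrite !inE njo.
Qed.

(** Every density involved is affine in the characters, so the interaction can
    be computed one character at a time. *)
Lemma interaction_star_measure T o : (2 < n)%N -> lower_set T ->
  (forall i j, i != j -> merge i j \in T) ->
  forall A, interaction T (star_measure o (~: [set o])) A = 0.
Proof.
move=> n_gt2 [TPi zT oT _] mT A.
have neq1 (s : {set {set 'I_n}}) : (1 < #|s|)%N -> s != one_hat n.
  by apply: contraTneq => ->; rewrite finset.cards1.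
have inPi pi : pi \in T -> pi \in Pi n by move/fintype.subsetP: TPi; apply.
pose mu pi : R := (mobius (@refines n) T pi (one_hat n))%:~R.
have mu_above (s : {set {set 'I_n}}) : s \in T -> (1 < #|s|)%N ->
    \sum_(pi in T) mu pi * (refines s pi)%:R = 0.
  move=> sT /neq1 ns1; rewrite -[RHS](mulr0z 1) -(mobius_sum_above TPi sT oT ns1).
  rewrite rmorph_sum /= big_mkcondr; apply: eq_bigr => pi _.
  by case: ifP; rewrite ?mulr1 ?mulr0.
have mu0 : \sum_(pi in T) mu pi = 0.
  rewrite -[RHS](mu_above _ zT).
    by apply: eq_bigr => pi /inPi piP; rewrite refines_zero_hat // mulr1.
  by rewrite card_imset ?card_ord ?(ltn_trans _ n_gt2) //; apply: finset.set1_inj.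
have muj j : j != o -> \sum_(pi in T) mu pi * (j \in finset.pblock pi o)%:R = 0.
  rewrite eq_sym => noj; rewrite -[RHS](mu_above _ (mT _ _ noj)).
    by apply: eq_bigr => pi /inPi piP; rewrite refines_merge.
  by rewrite card_merge // -subn1 ltn_subRL addn1.
rewrite /interaction (eq_bigr (fun pi => \sum_w 2^-1 ^+ n * \1_A (embed w) *
  (mu pi + n%:R^-1 * \sum_(j | j != o)
     chi R [set o; j] w * (mu pi * (j \in finset.pblock pi o)%:R)))); last first.
  move=> pi /inPi piP; rewrite product_star_measure // /star_measure mulr_sumr.
  apply: eq_bigr => w _; rewrite -/(mu pi) mulrAC mulrCA; congr (_ * _).
  rewrite /star mulrDr mulr1 mulrCA mulr_sumr.
  congr (_ + _ * _); rewrite big_mkcond [RHS]big_mkcond; apply: eq_bigr => j _.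
  by rewrite !inE; case: eqP => //= _; case: ifP; rewrite ?mulr0 ?mulr1 // mulrC.
rewrite exchange_big big1 //= => w _.
rewrite -mulr_sumr big_split /= mu0 add0r -mulr_sumr exchange_big big1 ?mulr0 //= => j nj.
by rewrite -mulr_sumr muj // mulr0.
Qed.

End StarMeasure.

Theorem lemma3p7 (R : realType) (n : nat) (hn : (3 <= n)%N)
  (T : {set {set {set 'I_n}}}) (hT : lower_set T)
  (hTn : [set pi in Pi n | #|pi| == n.-1] \subset T)
  (X : 'I_n -> choiceType)
  (hX : forall i : 'I_n, ([set: 'I_2] #<= [set: X i])%card) :
  exists P : set (forall i : 'I_n, X i) -> R,
    [/\ discrete_probability P,
        forall A : set (forall i : 'I_n, X i), interaction T P A = 0 &
        forall pi : {set {set 'I_n}}, pi \in Pi n -> pi != one_hat n ->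
          P <> product_marginals P pi].
Proof.
have two i : exists ab : X i * X i, ab.1 <> ab.2.
  have /card_leP[f] := hX i.
  pose u k : [set: 'I_2]%classic := exist _ k (in_setT k).
  exists (val (f (u ord0)), val (f (u ord_max))) => /= /val_inj f01.
  by have /(congr1 (val \o val)) := inj (in_setT _) (in_setT _) f01.
pose ab i := projT1 (cid (two i)).
have abE i : (ab i).1 <> (ab i).2 := projT2 (cid (two i)).
pose o : 'I_n := Ordinal (ltn_trans (isT : (0 < 2)%N) hn).
exists (star_measure R (fun i => (ab i).1) (fun i => (ab i).2) o (~: [set o])); split.
- exact: discrete_probability_star_measure.
- apply: interaction_star_measure => // i j nij; apply: (fintype.subsetP hTn).
  by rewrite inE merge_Pi card_merge //=.
- by move=> pi; apply: star_measure_neq_product.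
Qed.
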